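(* Let $\mathbb{K}\in\{\mathbb{R},\mathbb{C}\}$ and $N\ge 2$. If $\Phi=\{\varphi_i\}_{i=1}^M$ is an equiangular finite unit norm tight frame of $M$ vectors in $\mathbb{K}^N$, then $\Phi$ is prime.
   Context: A finite collection $\Phi=\{\varphi_i\}_{i=1}^M\subset\mathbb{K}^N$ ($M\ge N$) is a tight frame for $\mathbb{K}^N$ if there is $A>0$ with $\sum_{i=1}^M|\langle x,\varphi_i\rangle|^2=A\|x\|^2$ for all $x\in\mathbb{K}^N$. It is a finite unit norm tight frame (FUNTF) if in addition $\|\varphi_i\|=1$ for all $i$. A FUNTF is equiangular if there is a constant $c\ge 0$ with $|\langle\varphi_i,\varphi_j\rangle|=c$ for all $i\ne j$. A tight frame is prime if no proper sub-collection (indexed by a proper subset of $\{1,\dots,M\}$) is a tight frame for $\mathbb{K}^N$. *)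

(* Defs.v *)
From HB Require Import structures.
From mathcomp Require Import all_boot all_order all_algebra.
From mathcomp Require Import complex reals.

Set Implicit Arguments.
Unset Strict Implicit.
Unset Printing Implicit Defensive.

Import Order.TTheory GRing.Theory Num.Theory.
Local Open Scope ring_scope.

(* The record only carries data: it is used solely at the two instances
   [real_scalars] and [complex_scalars] below, the real numbers being an
   arbitrary [R : realType]. The modulus is [R]-valued, so that frame bounds
   and norms are real numbers in both cases. *)
Record scalars (R : realType) := Scalars {
  scalar :> fieldType;
  conj_scalar : scalar -> scalar;
  modulus : scalar -> R
}.

Definition real_scalars (R : realType) : scalars R :=
  @Scalars R R (fun z => z) (fun z => `|z|).

Definition complex_scalars (R : realType) : scalars R :=
  @Scalars R (complex R) (@conjc R) (@ComplexField.Normc.normc R).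

Section Frames.
Variables (R : realType) (K : scalars R) (N M : nat).

Definition inner (x y : 'rV[K]_N) : K :=
  \sum_(k < N) x 0 k * conj_scalar (y 0 k).

Definition vnorm (x : 'rV[K]_N) : R :=
  Num.sqrt (\sum_(k < N) modulus (x 0 k) ^+ 2).

(* Vectors may repeat, so a sub-collection of [phi] is given by its index
   set [J]. *)
Definition tight_subframe (phi : 'I_M -> 'rV[K]_N) (J : {set 'I_M}) : Prop :=
  (N <= #|J|)%N /\
  exists2 A : R, 0 < A &
    forall x : 'rV[K]_N,
      \sum_(i in J) modulus (inner x (phi i)) ^+ 2 = A * vnorm x ^+ 2.

Definition tight_frame (phi : 'I_M -> 'rV[K]_N) : Prop :=
  tight_subframe phi [set: 'I_M].

Definition funtf (phi : 'I_M -> 'rV[K]_N) : Prop :=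
  tight_frame phi /\ forall i, vnorm (phi i) = 1.

Definition equiangular (phi : 'I_M -> 'rV[K]_N) : Prop :=
  exists2 c : R, 0 <= c &
    forall i j, i != j -> modulus (inner (phi i) (phi j)) = c.

Definition prime_frame (phi : 'I_M -> 'rV[K]_N) : Prop :=
  tight_frame phi /\
  forall J : {set 'I_M}, J \proper [set: 'I_M] -> ~ tight_subframe phi J.

End Frames.

(* Main.v *)
(** Suppose that the sub-collection indexed by a proper subset [J], with
    [m = #|J|], is tight with bound [A].  Testing tightness at a vector of the
    sub-collection gives [1 + (m - 1) c^2 = A], and testing it at a vector
    outside gives [m c^2 = A]; hence [c^2 = 1] and [A = m].  Summing over the
    standard basis gives [m = A N], so [N = 1]. *)

Require Import Defs.
From mathcomp Require Import all_boot all_order all_algebra.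
From mathcomp Require Import complex reals.
From mathcomp Require Import ring.

Import Order.TTheory GRing.Theory Num.Theory.
Local Open Scope ring_scope.

Section ScalarFacts.
Context {R : realType} {K : scalars R}.
Hypothesis hK : K = real_scalars R \/ K = complex_scalars R.

Lemma modulus0 : modulus (0 : K) = 0.
Proof.
case: hK => ->; first exact: normr0.
exact: ComplexField.Normc.normc0.
Qed.

Lemma modulus1 : modulus (1 : K) = 1.
Proof.
case: hK => ->; first exact: normr1.
exact: ComplexField.Normc.normc1.
Qed.

Lemma modulus_conj (z : K) : modulus (conj_scalar z) = modulus z.
Proof.
case: hK z => -> //= [a b].
by rewrite /= sqrrN.
Qed.

Lemma vnorm_sqr N (x : 'rV[K]_N) :
  vnorm x ^+ 2 = \sum_(k < N) modulus (x 0 k) ^+ 2.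
Proof. by rewrite sqr_sqrtr// sumr_ge0// => k _; exact: sqr_ge0. Qed.

(** Each term [z * conj_scalar z] is the nonnegative real [modulus z ^+ 2], so taking the modulus of
    the sum changes nothing. *)
Lemma modulus_inner_self N (x : 'rV[K]_N) :
  modulus (inner x x) = vnorm x ^+ 2.
Proof.
rewrite vnorm_sqr /inner; case: hK x => -> x /=.
  rewrite ger0_norm; last by apply: sumr_ge0 => k _; rewrite -expr2 sqr_ge0.
  by apply: eq_bigr => k _; rewrite real_normK ?num_real// expr2.
have mul_conjc (z : R[i]) :
    z * conjc z = ((ComplexField.Normc.normc z) ^+ 2)%:C%C.
  case: z => a b /=; rewrite sqr_sqrtr ?addr_ge0 ?sqr_ge0//.
  by apply/eqP; rewrite eq_complex /=; apply/andP; split; apply/eqP; ring.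
rewrite (eq_bigr _ (fun k _ => mul_conjc (x 0 k))).
rewrite -(rmorph_sum (real_complex R)) /= expr0n addr0 sqrtr_sqr ger0_norm//.
by apply: sumr_ge0 => k _; exact: sqr_ge0.
Qed.

Lemma inner_delta N (k : 'I_N) (y : 'rV[K]_N) :
  inner (delta_mx 0 k) y = conj_scalar (y 0 k).
Proof.
rewrite /inner (bigD1 k)//= mxE !eqxx mul1r big1 ?addr0// => l lk.
by rewrite mxE eqxx (negbTE lk) mul0r.
Qed.

Lemma vnorm_delta_sqr N (k : 'I_N) :
  vnorm (delta_mx 0 k : 'rV[K]_N) ^+ 2 = 1.
Proof.
rewrite vnorm_sqr (bigD1 k)//= mxE !eqxx modulus1 expr1n big1 ?addr0// => l lk.
by rewrite mxE eqxx (negbTE lk) modulus0 expr0n.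
Qed.

(** Both sides are the trace of the frame operator: tightness at each standard basis vector yields
    one copy of [A], and exchanging the sums collects the entries of each [phi i]. *)
Lemma frame_bound_trace N M (phi : 'I_M -> 'rV[K]_N) (J : {set 'I_M}) (A : R) :
  (forall x : 'rV[K]_N,
    \sum_(i in J) modulus (inner x (phi i)) ^+ 2 = A * vnorm x ^+ 2) ->
  \sum_(i in J) vnorm (phi i) ^+ 2 = A * N%:R.
Proof.
move=> tightJ.
under eq_bigr do rewrite vnorm_sqr.
rewrite exchange_big /= -[N in RHS]card_ord mulr_natr -sumr_const.
apply: eq_bigr => k _; rewrite -[RHS]mulr1 -(vnorm_delta_sqr N k) -tightJ.
by apply: eq_bigr => i _; rewrite inner_delta modulus_conj.
Qed.

End ScalarFacts.

Theorem theorem3p2 (R : realType) (K : scalars R)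
    (hK : K = real_scalars R \/ K = complex_scalars R)
    (N M : nat) (hN : (2 <= N)%N)
    (phi : 'I_M -> 'rV[K]_N) :
  funtf phi -> equiangular phi -> prime_frame phi.
Proof.
move=> [tight_phi unit_phi] [c _ angle]; split=> // J /properP[_ [j0 _ j0J]].
move=> [leNJ [A _ tightJ]].
have J_gt0 : (0 < #|J|)%N by apply: leq_trans leNJ; apply: leq_trans hN.
have [j jJ] : exists j, j \in J by apply/card_gt0P.
have outside : A = c ^+ 2 *+ #|J|.
  (* Tightness at [phi j0]: since [j0] is outside [J], all [#|J|] terms equal [c ^+ 2]. *)
  rewrite -[A]mulr1 -(expr1n _ 2) -(unit_phi j0) -tightJ -sumr_const.
  by apply: eq_bigr => i iJ; rewrite angle//; apply: contraNneq j0J => ->.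
have inside : A = 1 + c ^+ 2 *+ #|J|.-1.
  (* Tightness at [phi j]: the term of index [j] is 1, the other [#|J|.-1] are [c ^+ 2]. *)
  rewrite -[A]mulr1 -(expr1n _ 2) -{1}(unit_phi j) -tightJ (bigD1 j)//=.
  rewrite (modulus_inner_self hK) unit_phi !expr1n; congr (_ + _).
  rewrite (eq_bigr (fun=> c ^+ 2)); last first.
    by move=> i /andP[_ ij]; rewrite angle// eq_sym.
  rewrite (cardsD1 j) jJ /= -sumr_const; apply: eq_bigl => i.
  by rewrite !inE andbC.
have c1 : c ^+ 2 = 1.
  (* After this addition the two sides are the two expressions for [A]. *)
  apply: (addIr (c ^+ 2 *+ #|J|.-1)).
  by rewrite -mulrS prednK// -outside.
have trace : #|J|%:R = A * N%:R.
  rewrite -(frame_bound_trace hK _ _ _ _ _ tightJ) -sumr_const.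
  by apply: eq_bigr => i _; rewrite unit_phi expr1n.
(* Now [A] is [#|J|]; cancelling this positive factor leaves [N = 1], against [hN]. *)
move/eqP: trace; rewrite outside c1 -natrM eqr_nat -{1}[#|J|]muln1.
by rewrite eqn_pmul2l// => /eqP N1; rewrite -N1 in hN.
Qed.
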